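(* Every planar convex domain $D\subset\mathbb{R}^2$ (a convex compact set with non-empty interior) possesses optimal polynomial meshes; that is, there exist constants $\mu,\nu>0$ depending only on $D$ and a sequence $\{Y_n\}_{n\ge1}$ of finite subsets of $D$ such that for every integer $n\ge1$ the cardinality of $Y_n$ is at most $\mu n^2$ and $$\max_{\boldsymbol{x}\in D}|p(\boldsymbol{x})|\le\nu\max_{\boldsymbol{x}\in Y_n}|p(\boldsymbol{x})|\quad\text{for every } p\in\Pi_{n,2}.$$
   Context: $\Pi_{n,2}$ is the space of real algebraic polynomials of total degree $\le n$ in $2$ variables. *)

(* Defs.v *)
From HB Require Import structures.
From mathcomp Require Import all_boot all_order all_algebra finmap.
(* The notations of mpoly clash with those of MathComp-Analysis. *)
From mathcomp Require Import -(notations) mpoly.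
From mathcomp Require Import all_classical all_reals all_analysis.

Set Implicit Arguments.
Unset Strict Implicit.
Unset Printing Implicit Defensive.

Import Order.TTheory GRing.Theory Num.Theory.
Import numFieldNormedType.Exports.

Local Open Scope classical_set_scope.
Local Open Scope ring_scope.

(* [mpoly.mmeasure mpoly.mdeg p] is what mpoly abbreviates as [msize p]: one
   plus the total degree of p, and 0 for the zero polynomial. *)
Definition Pi2 (R : realType) (n : nat) : set (mpoly.mpoly 2 R) :=
  [set p | (mpoly.mmeasure mpoly.mdeg p <= n.+1)%N].

Definition peval (R : realType) (p : mpoly.mpoly 2 R) (x : 'rV[R]_2) : R :=
  mpoly.meval (fun i => x ord0 i) p.

(* The maximum of |p| over A, written as a supremum. It is attained when A is
   nonempty and compact ([max_absP]), and is 0 when A is empty. *)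
Definition max_abs (R : realType) (A : set 'rV[R]_2) (p : mpoly.mpoly 2 R) : R :=
  sup [set `|peval p x| | x in A].

Lemma max_abs_set0 (R : realType) (p : mpoly.mpoly 2 R) : max_abs set0 p = 0.
Proof. by rewrite /max_abs image_set0 sup0. Qed.

Lemma continuous_peval (R : realType) (p : mpoly.mpoly 2 R) :
  continuous (peval p).
Proof.
move=> x; rewrite /continuous_at /peval mevalE.
under eq_fun do rewrite mevalE.
have Fx : Filter (nbhs x) by exact: nbhs_filter.
rewrite unlock; elim: (msupp p) => [|m s IHs] /=; first exact: cvg_cst.
apply: cvgD; last exact: IHs.
apply: cvgM; first exact: cvg_cst.
elim: (index_enum _) => [|i r IHr] /=; first exact: cvg_cst.
apply: cvgM; last exact: IHr.
apply: (@continuous_comp _ _ _ (fun y : 'rV[R]_2 => y ord0 i)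
  (fun t => t ^+ m i)); first exact: coord_continuous.
exact: exprn_continuous.
Qed.

Lemma max_absP (R : realType) (A : set 'rV[R]_2) (p : mpoly.mpoly 2 R) :
    A !=set0 -> compact A ->
  (exists2 c, A c & max_abs A p = `|peval p c|) /\
  (forall x, A x -> `|peval p x| <= max_abs A p).
Proof.
move=> A0 cA.
have cf : {within A, continuous (fun x => `|peval p x|)}.
  apply: continuous_subspaceT => x.
  apply: (@continuous_comp _ _ _ (peval p) (fun t : R => `|t|)).
    exact: continuous_peval.
  exact: norm_continuous.
have [c /[!inE] Ac cmax] := compact_EVT_max A0 cA cf.
have ub : ubound [set `|peval p x| | x in A] `|peval p c|.
  by move=> _ [x Ax <-]; apply: cmax; rewrite inE.
have Emax : max_abs A p = `|peval p c|.
  apply/eqP; rewrite eq_le ge_sup //=; last by exists `|peval p c|, c.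
  by apply: ub_le_sup; [exists `|peval p c| | exists c].
by split=> [|x Ax]; [exists c | rewrite Emax; apply: cmax; rewrite inE].
Qed.

(* Main.v *)
Require Import Defs.
From HB Require Import structures.
From mathcomp Require Import all_boot all_order all_algebra finmap.
From mathcomp Require Import -(notations) mpoly.
From mathcomp Require Import all_classical all_reals all_analysis.
From mathcomp Require Import ring lra zify.

Set Implicit Arguments.
Unset Strict Implicit.
Unset Printing Implicit Defensive.

Import Order.TTheory GRing.Theory Num.Theory.
Import numFieldNormedType.Exports.

Local Open Scope classical_set_scope.
Local Open Scope ring_scope.

(* Near a boundary arc, the domain lies below the graph of a concave function [F]
   (above the graph of [0]).  Moving vertically by [O(1/n^2)] at the graph changes
   a polynomial of degree [n] only by a small fraction of its maximum [M].  If at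
   [x] the parabola [- K h^2] tangent to the graph stays below it, up to an
   error [O(1/n^2)], then Bernstein's inequality along this parabola allows steps
   of size [c / (n sqrt K)] tangentially.  The points [x] where [K = 4^k] fails
   are those where the slope of [F] drops too much, at rate at least [4^k], on
   some interval ending at [x]; since the total drop is bounded, a Vitali covering
   argument (the weak type inequality for the maximal function of [-F'']) shows
   that steps of size [c / (n 2^k)] on this set need only [O(n / 2^k)] points.
   Summing over [k], the graph carries a mesh of [O(n)] points, and its dilations
   by [O(n)] Chebyshev ratios give a mesh of [O(n^2)] points of the region below
   it.  Finitely many such regions cover the domain. *)

(** * Bernstein's inequality for algebraic polynomials *)

(** Multiplying by [sin (be / 2)] turns each term into a difference of consecutive half-shifted
    cosines; the sum telescopes, and its two ends agree by the periodicity hypothesis. *)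
Lemma sum_sin_progression (R : realType) (N : nat) (al be : R) :
  sin (be / 2) != 0 -> cos (al - be / 2 + N%:R * be) = cos (al - be / 2) ->
  \sum_(k < N) sin (al + k%:R * be) = 0.
Proof.
move=> sb per; apply: (mulIf sb); rewrite mul0r mulr_suml.
pose f (k : nat) : R := - cos (al - be / 2 + k%:R * be) / 2.
transitivity (\sum_(0 <= k < N) (f k.+1 - f k)).
  rewrite big_mkord; apply: eq_bigr => k _; rewrite /f.
  have -> : al - be / 2 + k.+1%:R * be = (al + k%:R * be) + be / 2.
    by rewrite -natr1; by field.
  have -> : al - be / 2 + k%:R * be = (al + k%:R * be) - be / 2 by ring.
  rewrite cosD cosB; by field.
by rewrite (telescope_sumr f (leq0n N)) /f per mul0r addr0 subrr.
Qed.

Definition node (R : realType) (N k : nat) : R := 2 * pi * k%:R / N%:R.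

Lemma cosD_2pi_nat (R : realType) (m : nat) (x : R) :
  cos (x + 2 * pi * m%:R) = cos x.
Proof.
have -> : 2 * pi * m%:R = (pi : R) *+ 2 *+ m.
  by ring.
by rewrite periodicn //; exact: cosD2pi.
Qed.

Lemma sum_sin_node_lt (R : realType) (N p q : nat) (al : R) :
  (p < q)%N -> (q < p + N)%N ->
  \sum_(k < N) sin (al + (q%:R - p%:R) * node R N k) = 0.
Proof.
move=> pq qN; have N0 : (0 < N)%N by case: N qN => //; rewrite addn0 ltnNge ltnW.
have N0' : (0 : R) < N%:R by rewrite ltr0n.
have dE : (q%:R - p%:R : R) = (q - p)%:R by rewrite natrB // ltnW.
pose be : R := 2 * pi * (q - p)%:R / N%:R.
have d0 : (0 : R) < (q - p)%:R by rewrite ltr0n subn_gt0.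
have dN : ((q - p)%:R : R) < N%:R by rewrite ltr_nat ltn_subLR // ltnW.
rewrite (eq_bigr (fun k : 'I_N => sin (al + k%:R * be))) => [|k _]; last first.
  by rewrite dE /node /be; congr (sin (_ + _)); ring.
apply: sum_sin_progression.
  rewrite gt_eqF //; apply: sin_gt0_pi.
  have -> : be / 2 = pi * ((q - p)%:R / N%:R).
    by rewrite /be; field; rewrite gt_eqF.
  rewrite mulr_gt0 ?pi_gt0 ?divr_gt0 //=.
  by rewrite -{2}[pi]mulr1 ltr_pM2l ?pi_gt0 // ltr_pdivrMr // mul1r.
have -> : N%:R * be = 2 * pi * (q - p)%:R.
  by rewrite /be; field; rewrite gt_eqF.
exact: cosD_2pi_nat.
Qed.

(** Discrete orthogonality. A frequency is given as a difference of two naturals, and the two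
    inequalities keep its absolute value below [N], so that no nonzero frequency aliases to 0. *)
Lemma sum_sin_node (R : realType) (N p q : nat) (al : R) :
  (p < q + N)%N -> (q < p + N)%N ->
  \sum_(k < N) sin (al + (p%:R - q%:R) * node R N k) =
  N%:R * sin al * (p == q)%:R.
Proof.
move=> pN qN; case: ltngtP => [pq|qp|->] /=.
- rewrite mulr0; apply: oppr_inj; rewrite oppr0 -sumrN.
  rewrite -[RHS](@sum_sin_node_lt R N p q (- al) pq qN).
  by apply: eq_bigr => k _; rewrite -sinN; congr sin; ring.
- by rewrite sum_sin_node_lt // mulr0.
- under eq_bigr do rewrite subrr mul0r addr0.
  by rewrite sumr_const card_ord mulr1 mulr_natl.
Qed.

(** [n] times the usual Fejer kernel: the squared modulus of the sum of [exp (i a t)] over [a < n],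
    hence nonnegative. *)
Definition fejer (R : realType) (n : nat) (t : R) : R :=
  \sum_(a < n) \sum_(b < n) cos ((a%:R - b%:R) * t).

Lemma fejer_ge0 (R : realType) n (t : R) : 0 <= fejer n t.
Proof.
have -> : fejer n t =
    (\sum_(a < n) cos (a%:R * t)) ^+ 2 + (\sum_(a < n) sin (a%:R * t)) ^+ 2.
  rewrite /fejer !expr2 !mulr_suml -big_split; apply: eq_bigr => a _ /=.
  rewrite !mulr_sumr -big_split; apply: eq_bigr => b _ /=.
  by rewrite mulrBl cosB.
by rewrite addr_ge0 ?sqr_ge0.
Qed.

Lemma sum_fejer_node (R : realType) (n : nat) :
  \sum_(k < 3 * n) fejer n (node R (3 * n) k) = (3 * n)%:R * n%:R.
Proof.
rewrite /fejer exchange_big /=.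
under eq_bigr => a _ do rewrite exchange_big /=.
have E (a b : 'I_n) : \sum_(k < 3 * n) cos ((a%:R - b%:R) * node R (3 * n) k) =
    (3 * n)%:R * (a == b)%:R.
  have an := ltn_ord a; have bn := ltn_ord b.
  (* The phase [al = pi / 2] turns the sines of [sum_sin_node] into cosines. *)
  rewrite -[RHS](_ : (3 * n)%:R * sin (pi / 2) * (a == b :> nat)%:R = _); last first.
    by rewrite sin_pihalf mulr1.
  rewrite -sum_sin_node; try lia.
  by apply: eq_bigr => k _; rewrite [_ + (_ * _)]addrC sinDpihalf.
under eq_bigr => a _ do under eq_bigr => b _ do rewrite E.
under eq_bigr => a _.
  rewrite (bigD1 a) //= eqxx mulr1 big1 ?addr0; last first.
    by move=> b /negPf; rewrite eq_sym => ->; rewrite mulr0.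
  over.
by rewrite sumr_const card_ord mulr_natr.
Qed.

(** This is the triangular coefficient of the Fejer kernel at frequency [n - j]: each [a < j] has
    the single partner [b = n + a - j], and the other [a] have none. *)
Lemma count_shift (R : realType) (n j : nat) : (j <= n)%N ->
  \sum_(a < n) \sum_(b < n) ((j + b == n + a)%N%:R : R) = j%:R.
Proof.
move=> jn.
transitivity (\sum_(a < n) ((a < j)%N%:R : R)).
  apply: eq_bigr => a _; case: (ltnP a j) => aj.
    have H : (n + a - j < n)%N by have := ltn_ord a; lia.
    rewrite (bigD1 (Ordinal H)) //= big1 ?addr0.
      by rewrite (_ : (_ == _)%N = true) //; lia.
    move=> b /eqP nb; case: eqP => // Eb; case: nb; apply: val_inj => /=; lia.
  by rewrite big1 // => b _; case: eqP => // Eb; have := ltn_ord b; lia.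
rewrite -(big_mkord xpredT (fun a => ((a < j)%N%:R : R))).
rewrite (@big_cat_nat _ _ _ j) //= [X in _ + X]big_nat_cond [X in _ + X]big1 ?addr0.
  rewrite big_nat_cond (eq_bigr (fun=> 1)) => [|a /andP[/andP[_ ->]] //].
  by rewrite -big_nat_cond sumr_const_nat subn0.
by move=> a /andP[/andP[ja _] _]; rewrite ltnNge ja.
Qed.

(* Multiplication by [sin (n t)] shifts the triangular Fourier coefficients of
   the Fejer kernel by [n], so that on [[-n, n]] they become proportional to
   the frequency; the nodes integrate frequencies up to [3 n - 1] exactly. *)
Lemma fejer_sin_derivative (R : realType) (n j : nat) (th : R) : (j <= n)%N ->
  (0 < n)%N ->
  \sum_(k < 3 * n) cos (j%:R * (th + node R (3 * n) k)) *
    (sin (n%:R * node R (3 * n) k) * fejer n (node R (3 * n) k)) =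
  - ((3 * n)%:R / 2 * (j%:R * sin (j%:R * th))).
Proof.
move=> jn n0.
pose ph k := node R (3 * n) k.
pose S p q k := sin (j%:R * th + (p%:R - q%:R) * ph k).
transitivity (\sum_(a < n) \sum_(b < n) \sum_(k < 3 * n)
   ((S (j + n + a) b k + S (j + n + b) a k
    - S (j + b) (n + a) k - S (j + a) (n + b) k) / 4)%N).
  rewrite -[RHS](eq_bigr _ (fun a _ => exchange_big _ _ _ _ _ _)) exchange_big /=.
  apply: eq_bigr => k _; rewrite /fejer mulrA mulr_sumr; apply: eq_bigr => a _.
  rewrite mulr_sumr; apply: eq_bigr => b _; rewrite /S -/(ph k) !natrD.
  set A := j%:R * (th + ph k); set B := n%:R * ph k; set C := (a%:R - b%:R) * ph k.
  have -> : j%:R * th + (j%:R + n%:R + a%:R - b%:R) * ph k = A + (B + C).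
    by rewrite /A /B /C; ring.
  have -> : j%:R * th + (j%:R + n%:R + b%:R - a%:R) * ph k = A + (B - C).
    by rewrite /A /B /C; ring.
  have -> : j%:R * th + (j%:R + b%:R - (n%:R + a%:R)) * ph k = A - (B + C).
    by rewrite /A /B /C; ring.
  have -> : j%:R * th + (j%:R + a%:R - (n%:R + b%:R)) * ph k = A - (B - C).
    by rewrite /A /B /C; ring.
  by rewrite !(sinD A) !(sinN, cosN) !(sinD B, cosD B) !(sinN, cosN); field.
(* The first two families of sines have positive frequency and sum to 0; the other two survive
   exactly when [j + b = n + a], respectively [j + a = n + b]. *)
transitivity (\sum_(a < n) \sum_(b < n)
   (- ((3 * n)%:R * sin (j%:R * th) / 4) *
    ((j + b == n + a)%N%:R + (j + a == n + b)%N%:R) : R)).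
  apply: eq_bigr => a _; apply: eq_bigr => b _.
  have an := ltn_ord a; have bn := ltn_ord b.
  rewrite -mulr_suml !big_split /= !sumrN !sum_sin_node; try lia.
  have -> : (j + n + a == b)%N = false by apply/eqP; lia.
  have -> : (j + n + b == a)%N = false by apply/eqP; lia.
  by rewrite /=; by field.
under eq_bigr do rewrite -mulr_sumr big_split /=.
rewrite -mulr_sumr big_split /= count_shift //.
rewrite [X in _ + X]exchange_big /= count_shift //; by field.
Qed.

Lemma poly_cosE (R : realType) (n : nat) (q : {poly R}) : (size q <= n.+1)%N ->
  exists a : nat -> R, forall th,
    q.[cos th] = \sum_(j < n.+1) a j * cos (j%:R * th).
Proof.
elim: n q => [|n IHn] q sq.
  exists (fun=> q`_0) => th; rewrite (size1_polyC sq) hornerC big_ord1 mul0r cos0.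
  by rewrite coefC eqxx mulr1.
have [a aE] : exists a : nat -> R, forall th,
    (drop_poly 1 q).[cos th] = \sum_(j < n.+1) a j * cos (j%:R * th).
  by apply: IHn; rewrite size_drop_poly subn1; case: (size q) sq.
(* cos th * cos (j th) = (cos ((j+1) th) + cos (|j-1| th)) / 2 *)
exists (fun j => (j == 0)%N%:R * q`_0 + (if j is i.+1 then a i / 2 else 0) +
   (if (j < n)%N then a j.+1 / 2 else 0) + (if j == 1%N then a 0%N / 2 else 0)).
move=> th; rewrite -[q in LHS](poly_take_drop 1) hornerD hornerM hornerXn expr1.
have -> : (take_poly 1 q).[cos th] = q`_0.
  rewrite (@size1_polyC _ (take_poly 1 q)) ?size_take_poly //.
  by rewrite hornerC coef_take_poly.
rewrite aE mulr_suml.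
under [RHS]eq_bigr do rewrite 3!mulrDl.
rewrite !big_split /=.
have -> : \sum_(i < n.+2) (i == 0%N :> nat)%:R * q`_0 * cos (i%:R * th) = q`_0.
  rewrite big_ord_recl /= mul0r cos0 mul1r mulr1 big1 ?addr0 // => i _.
  by rewrite /= !mul0r.
rewrite -!addrA; congr (_ + _).
rewrite [X in _ = X + _]big_ord_recl /= mul0r add0r.
have -> : \sum_(i < n.+2) (if (i < n)%N then a i.+1 / 2 else 0) * cos (i%:R * th)
   = \sum_(i < n) a i.+1 / 2 * cos (i%:R * th).
  rewrite !big_ord_recr /= ltnn ltnNge leqnSn /= !mul0r !addr0.
  by apply: eq_bigr => i _; rewrite ltn_ord.
have -> : \sum_(i < n.+2) (if i == 1%N :> nat then a 0%N / 2 else 0) * cos (i%:R * th)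
   = a 0%N / 2 * cos th.
  rewrite !big_ord_recl /= mul0r add0r big1 ?addr0 ?mul1r // => i _.
  by rewrite mul0r.
rewrite big_ord_recl /= mul0r cos0 mulr1 [in RHS]big_ord_recl /=.
rewrite [RHS](_ : _ = a 0%N * cos th + \sum_(i < n)
  (a i.+1 / 2 * cos ((lift ord0 i).+1%:R * th) + a i.+1 / 2 * cos (i%:R * th))).
  congr (_ + _); apply: eq_bigr => i _.
  rewrite /= /bump /= add1n.
  have -> : i.+2%:R * th = i.+1%:R * th + th by rewrite -natr1; ring.
  have -> : i%:R * th = i.+1%:R * th - th by rewrite -natr1; ring.
  rewrite cosD cosB; by field.
rewrite big_split /= /bump /= !add1n mul1r; lra.
Qed.

(** By [fejer_sin_derivative], the derivative of [q (cos x)] is a weighted sum of its values at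
    shifted nodes. The weights are bounded by the Fejer kernel, whose sum over the nodes is known;
    this gives the constant [2 * n]. *)
Lemma bernstein_lipschitz (R : realType) (n : nat) (q : {poly R}) (M th ph : R) :
  (0 < n)%N -> (size q <= n.+1)%N ->
  (forall x : R, -1 <= x <= 1 -> `|q.[x]| <= M) ->
  `|q.[cos th] - q.[cos ph]| <= 2 * n%:R * M * `|th - ph|.
Proof.
move=> n0 sq qM; have [a aE] := poly_cosE sq.
pose u (x : R) := \sum_(j < n.+1) a j * cos (j%:R * x).
pose du (x : R) := \sum_(j < n.+1) a j * (- (j%:R * sin (j%:R * x))).
have n0' : (0 : R) < n%:R by rewrite ltr0n.
have uM x : `|u x| <= M by rewrite /u -aE qM // cos_geN1 cos_le1.
have M0 : 0 <= M by exact: le_trans (uM 0).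
have uE : u = \sum_(j < n.+1) (fun x => a j * cos (j%:R * x)).
  by apply/funext => y; rewrite /u fct_sumE.
have D (x : R) : is_derive x (1 : R) u (du x).
  rewrite uE /du; apply: is_derive_sum => j.
  have Dj : is_derive x 1 (j%:R \*: (@id R)) (j%:R *: 1) by exact: is_deriveZ.
  have Dc := is_derive1_comp (is_derive_cos ((j%:R \*: (@id R)) x)) Dj.
  apply: (@is_derive_eq _ _ _ _ _ _ _ _ (is_deriveZ (a j) Dc)).
  by rewrite /GRing.scale /=; ring.
have duM x : `|du x| <= 2 * n%:R * M.
  have -> : du x = 2 / (3 * n)%:R * \sum_(k < 3 * n) u (x + node R (3 * n) k) *
     (sin (n%:R * node R (3 * n) k) * fejer n (node R (3 * n) k)).
    rewrite /u.
    under [in RHS]eq_bigr do rewrite mulr_suml.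
    rewrite exchange_big /= mulr_sumr; apply: eq_bigr => j _.
    under eq_bigr do rewrite -mulrA.
    rewrite -mulr_sumr fejer_sin_derivative //; last by rewrite -ltnS.
    by rewrite natrM; field; rewrite gt_eqF.
  rewrite normrM ger0_norm ?divr_ge0 //.
  rewrite (le_trans (ler_wpM2l _ (ler_norm_sum _ _ _))) ?divr_ge0 //.
  rewrite (@le_trans _ _ (2 / (3 * n)%:R * \sum_(k < 3 * n) M * fejer n (node R (3 * n) k))) //.
    apply: ler_wpM2l; first by rewrite divr_ge0.
    apply: ler_sum => k _; rewrite !normrM ler_pM ?mulr_ge0 //.
    by rewrite (ger0_norm (fejer_ge0 _ _)) ler_piMl ?fejer_ge0 ?sin_max.
  rewrite -mulr_sumr sum_fejer_node natrM.
  by rewrite le_eqVlt; apply/orP; left; apply/eqP; field; rewrite gt_eqF.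
wlog le_ph_th : th ph / ph <= th.
  move=> H; have [/H//|/ltW/H] := leP ph th.
  by rewrite distrC [X in _ <= _ * X]distrC.
have [|c _] := @MVT_segment R u du ph th le_ph_th (fun x _ => D x).
  apply: continuous_subspaceT => x.
  apply/differentiable_continuous/derivable1_diffP/(@ex_derive _ _ _ _ _ _ _ (D x)).
by rewrite /u -!aE => ->; rewrite normrM ler_wpM2r.
Qed.

Lemma dist_acos_pihalf (R : realType) (t : R) : `|t| <= 2^-1 ->
  `|acos t - pi / 2| <= 2 * `|t|.
Proof.
wlog t0 : t / 0 <= t.
  move=> H; have [/H//|/ltW t0] := leP 0 t.
  move=> tM; have := H (- t); rewrite oppr_ge0 normrN => /(_ t0 tM).
  rewrite acosN; last by have := ler_norml t 2^-1; rewrite tM => /esym; lra.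
  suff -> : pi - acos t - pi / 2 = - (acos t - pi / 2) by rewrite normrN.
  by lra.
rewrite ger0_norm // => th.
have D (x : R) : x \in `]0, t[ -> is_derive x 1 acos (- (Num.sqrt (1 - x ^+ 2))^-1).
  by rewrite in_itv /= => /andP[? ?]; apply: is_derive1_acos; lra.
have [|c] := @MVT_segment R acos (fun x => - (Num.sqrt (1 - x ^+ 2))^-1) 0 t t0 D.
  apply: continuous_in_subspaceT => x; rewrite inE /= in_itv /= => /andP[? ?].
  by apply: continuous_acos; lra.
rewrite in_itv /= acos0 subr0 => /andP[c0 ct] ->.
rewrite normrM (ger0_norm t0) normrN ler_wpM2r // ger0_norm ?invr_ge0 ?sqrtr_ge0 //.
have s2 : 2^-1 <= Num.sqrt (1 - c ^+ 2).
  rewrite -[2^-1]ger0_norm ?invr_ge0 // -sqrtr_sqr ler_wsqrtr //; nra.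
by rewrite -[leRHS]invrK lef_pV2 // posrE ?invr_gt0 //; apply: lt_le_trans s2; rewrite invr_gt0.
Qed.

(** In the angle variable [acos], which is 2-Lipschitz near the middle of the interval, this is
    [bernstein_lipschitz]. *)
Lemma bernstein_center (R : realType) (n : nat) (q : {poly R}) (M t : R) :
  (0 < n)%N -> (size q <= n.+1)%N ->
  (forall x : R, -1 <= x <= 1 -> `|q.[x]| <= M) -> `|t| <= 2^-1 ->
  `|q.[t] - q.[0]| <= 4 * n%:R * M * `|t|.
Proof.
move=> n0 sq qM tle.
have M0 : 0 <= M by apply: le_trans (qM 0 _); rewrite ?normr_ge0 //; lra.
rewrite -[t in q.[t]]acosK; last by rewrite in_itv /= -ler_norml; lra.
rewrite -[in q.[0]]cos_pihalf.
rewrite (le_trans (bernstein_lipschitz _ _ n0 sq qM)) //.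
rewrite (le_trans (ler_wpM2l _ (dist_acos_pihalf tle))) ?mulr_ge0 //.
by rewrite le_eqVlt; apply/orP; left; apply/eqP; ring.
Qed.

(** Composing with ['X^2] moves the endpoint 0 to the centre of [[-1, 1]] and doubles the degree. A
    displacement of order [1 / n^2] at the endpoint thus costs a small fraction of [M]. *)
Lemma bernstein_end (R : realType) (n : nat) (q : {poly R}) (M w : R) :
  (0 < n)%N -> (size q <= n.+1)%N ->
  (forall x : R, 0 <= x <= 1 -> `|q.[x]| <= M) -> `|w| <= 2^-1 ->
  `|q.[w ^+ 2] - q.[0]| <= 8 * n%:R * M * `|w|.
Proof.
move=> n0 sq qM wle.
have E x : (q \Po 'X^2).[x] = q.[x ^+ 2] by rewrite horner_comp hornerXn.
have E0 : q.[0] = (q \Po 'X^2).[0] by rewrite E expr0n.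
rewrite -E E0.
have -> : 8 * n%:R * M * `|w| = 4 * (2 * n)%:R * M * `|w| by rewrite natrM; ring.
apply: bernstein_center => //; first by rewrite muln_gt0.
  rewrite (leq_trans (size_comp_poly_leq _ _)) // size_polyXn ltnS mulnC.
  by rewrite leq_mul2l /=; case: (size q) sq.
by move=> x x1; rewrite E; apply: qM; nra.
Qed.

Definition cheb_node (R : realType) (n i : nat) : R :=
  (1 - cos (i%:R / (8 * n%:R))) / 2.

Lemma cheb_node_itv (R : realType) (n i : nat) : 0 <= cheb_node R n i <= 1.
Proof.
rewrite /cheb_node; have := cos_geN1 (i%:R / (8 * n%:R) : R).
by have := cos_le1 (i%:R / (8 * n%:R) : R); lra.
Qed.

(** The angles of the nodes are spaced by [1 / (8 n)], which against the Lipschitz constant [2 n M]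
    gives [M / 4]. Angles below 4 cover [[0, pi]], so fewer than [33 n] indices suffice. *)
Lemma cheb_node_dense (R : realType) (n : nat) (q : {poly R}) (M t : R) :
  (0 < n)%N -> (size q <= n.+1)%N ->
  (forall x : R, 0 <= x <= 1 -> `|q.[x]| <= M) -> 0 <= t <= 1 ->
  exists2 i, (i < 33 * n)%N & `|q.[t] - q.[cheb_node R n i]| <= M / 4.
Proof.
move=> n0 sq qM t01.
have M0 : 0 <= M by apply: le_trans (qM 0 _); rewrite ?normr_ge0 //; lra.
have n0' : (0 : R) < n%:R by rewrite ltr0n.
pose q' := q \Po ((1 / 2)%:P - (1 / 2) *: 'X).
have E x : q'.[x] = q.[(1 - x) / 2].
  by rewrite /q' horner_comp hornerD hornerN hornerZ hornerX hornerC; congr (q.[_]); lra.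
have sq' : (size q' <= n.+1)%N.
  rewrite (leq_trans (size_comp_poly_leq _ _)) // ltnS.
  have H : (size ((1 / 2)%:P - (1 / 2) *: 'X : {poly R})%R <= 2)%N.
    rewrite (leq_trans (size_polyD _ _)) // geq_max size_polyN.
    rewrite (leq_trans (size_polyC_leq1 _)) //=.
    by rewrite (leq_trans (size_scale_leq _ _)) // size_polyX.
  rewrite -[n in (_ <= n)%N]muln1 leq_mul //; last by case: (size _) H => [|[|[]]].
  by case: (size q) sq.
have q'M x : -1 <= x <= 1 -> `|q'.[x]| <= M by move=> ?; rewrite E; apply: qM; lra.
pose th := acos (1 - 2 * t); have t1 : -1 <= 1 - 2 * t <= 1 by lra.
have th0 : 0 <= th by exact: acos_ge0.
have th4 : th < 4.
  by apply: le_lt_trans (acos_lepi t1) _; have := @pihalf_lt2 R; lra.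
pose y := 8 * n%:R * th.
have y0 : 0 <= y by rewrite !mulr_ge0.
exists (Num.truncn y).
  by rewrite truncn_lt_nat // /y natrM; nra.
have -> : t = (1 - cos th) / 2 by rewrite acosK ?in_itv //=; lra.
rewrite -!E (le_trans (bernstein_lipschitz _ _ n0 sq' q'M)) //.
have d : `|th - (Num.truncn y)%:R / (8 * n%:R)| <= (8 * n%:R)^-1.
  have -> : th = y / (8 * n%:R) by rewrite /y; field; rewrite gt_eqF.
  have /andP[a b] := truncn_itv y0.
  rewrite -mulrBl normrM ger0_norm ?subr_ge0 //.
  rewrite [X in _ * X]ger0_norm ?invr_ge0 ?mulr_ge0 //.
  by rewrite ler_piMl ?invr_ge0 ?mulr_ge0 //; rewrite -natr1 in b; lra.
rewrite (le_trans (ler_wpM2l _ d)) ?mulr_ge0 //.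
by rewrite le_eqVlt; apply/orP; left; apply/eqP; field; rewrite gt_eqF.
Qed.

(** * A covering argument *)

Lemma seq_argmax (R : realType) (f : nat -> R) (s : seq nat) : s != [::] ->
  exists2 j, j \in s & forall i, i \in s -> f i <= f j.
Proof.
elim: s => // k s IHs _; have [->|/IHs[j js jmax]] := eqVneq s [::].
  by exists k; rewrite ?mem_head // => i; rewrite mem_seq1 => /eqP ->.
have [kj|jk] := leP (f k) (f j).
  by exists j; rewrite ?inE ?js ?orbT // => i /[!inE] /predU1P[->|/jmax].
exists k; rewrite ?mem_head // => i /[!inE] /predU1P[->//|/jmax ij].
exact: le_trans ij (ltW jk).
Qed.

Lemma count_multiples_itv (R : realType) (d al be : R) (s : seq nat) :
  0 < d -> al <= be -> uniq s ->
  (forall i, i \in s -> al <= i%:R * d <= be) ->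
  (size s)%:R <= (be - al) / d + 1.
Proof.
move=> d0 ab us sP.
have q0 : 0 <= (be - al) / d by rewrite divr_ge0 ?subr_ge0 // ltW.
have [->|s0] := eqVneq s [::]; first by rewrite addr_ge0.
have s_ex : exists i, i \in s by case: s s0 {us sP} => // i s _; exists i; rewrite mem_head.
have [m ms mmin] := ex_minnP s_ex.
set N := Num.truncn ((be - al) / d).
have NS : (size s <= size (iota m N.+1))%N.
  apply: uniq_leq_size => // i si; rewrite mem_iota mmin //= addnS ltnS -leq_subLR.
  rewrite truncn_ge_nat // ler_pdivlMr // natrB ?mmin //.
  by have := sP _ ms; have := sP _ si; lra.
rewrite size_iota -(ler_nat R) in NS; apply: le_trans NS _.
by rewrite -natr1 lerD2r; have /andP[] := truncn_itv q0.
Qed.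

(* A Vitali covering argument: removing the longest interval together with all
   those that meet it leaves two separated families. *)
Lemma vitali_count (R : realType) (G : R -> R) (x a b : nat -> R)
    (x0 d C A B : R) (s : seq nat) :
  0 < d -> 0 <= C -> A <= B ->
  (forall u v, A <= u -> u <= v -> v <= B -> G u <= G v) -> uniq s ->
  (forall i, i \in s -> [/\ A <= a i, a i <= x i <= b i, b i <= B,
     x0 + i%:R * d <= x i <= x0 + i.+1%:R * d &
     3 * (b i - a i) / d + 2 <= C * (G (b i) - G (a i))]) ->
  (size s)%:R <= C * (G B - G A).
Proof.
move=> d0 C0.
have [m] := ubnP (size s); elim: m s A B => // m IHm s A B sm AB Gmono us sP.
have [->|s0] := eqVneq s [::]; first by rewrite mulr_ge0 // subr_ge0 Gmono.
have [j js jmax] := seq_argmax (fun i => b i - a i) s0.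
have [Aa /andP[ax xb] bB /andP[cl cr] len] := sP j js.
pose s1 := [seq i <- s | b i < a j].
pose s' := [seq i <- s | ~~ (b i < a j)].
pose s2 := [seq i <- s' | b j < a i].
pose s3 := [seq i <- s' | ~~ (b j < a i)].
have size_s' : size s' = (size s2 + size s3)%N.
  by rewrite [size s2]size_filter [size s3]size_filter (count_predC (fun i => b j < a i)).
have sizeE : size s = (size s1 + (size s2 + size s3))%N.
  by rewrite -size_s' [size s1]size_filter [size s']size_filter (count_predC (fun i => b i < a j)).
have js3 : j \in s3 by rewrite !mem_filter js -!leNgt !(le_trans ax xb).
have s30 : (0 < size s3)%N by case: (s3) js3.
have [s1m s2m] : (size s1 < m)%N /\ (size s2 < m)%N.
  move: sm s30; rewrite sizeE; move: (size s1) (size s2) (size s3) => p q r; clear.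
  by split; lia.
(* The intervals of [s1] lie in [[A, a j]] and those of [s2] in [[b j, B]], so induction charges
   them to disjoint parts of the increase of [G]. *)
have H1 : (size s1)%:R <= C * (G (a j) - G A).
  apply: (IHm _ _ _ s1m); [lra| | exact: filter_uniq | ].
    by move=> u v Au uv va; apply: Gmono => //; lra.
  by move=> i; rewrite mem_filter => /andP[/ltW ? /sP[]]; split.
have H2 : (size s2)%:R <= C * (G B - G (b j)).
  apply: (IHm _ _ _ s2m); [lra| | by do 2 apply: filter_uniq | ].
    by move=> u v Au uv va; apply: Gmono => //; lra.
  by move=> i; rewrite !mem_filter => /and3P[/ltW ? _ /sP[]]; split.
(* Intervals meeting the longest one lie within its enlargement to three times its length; their
   sample points are in consecutive cells of width [d], hence the count, paid for by the increase of
   [G] on [[a j, b j]]. *)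
have H3 : (size s3)%:R <= 3 * (b j - a j) / d + 2.
  pose l := b j - a j; have l0 : 0 <= l by rewrite /l; lra.
  have := @count_multiples_itv R d (a j - l - x0 - d) (b j + l - x0) s3 d0.
  have -> : (b j + l - x0 - (a j - l - x0 - d)) / d + 1 = 3 * l / d + 2.
    by rewrite /l; field; rewrite gt_eqF.
  apply; [lra| by do 2 apply: filter_uniq |].
  move=> i; rewrite !mem_filter -!leNgt => /and3P[ba ab si].
  have [_ /andP[? ?] _ /andP[? +] _] := sP i si; have := jmax i si.
  by rewrite -/l -natr1 => ? ?; lra.
rewrite sizeE !natrD.
have : C * (G B - G A) = C * (G (a j) - G A) + C * (G B - G (b j)) + C * (G (b j) - G (a j)) by ring.
lra.
Qed.

(** * Meshes on the graph of a concave function *)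

Lemma exp4E (R : realType) (k : nat) : 4 ^+ k = (2 ^+ k) ^+ 2 :> R.
Proof. by rewrite exprAC; congr (_ ^+ _); rewrite expr2; lra. Qed.

(** The range [[-2, 2]] leaves room for steps of length at most 1 from base points in [[-1, 1]]. *)
Definition is_supergradient (R : realType) (F g : R -> R) : Prop :=
  forall x y, -2 <= x <= 2 -> -2 <= y <= 2 -> F y <= F x + g x * (y - x).

(* The parabola with leading coefficient [- 4 ^ k] tangent to the graph of [F]
   at [x], lowered by [t ^ 2], fails to stay below [F]. *)
Definition steep (R : realType) (F g : R -> R) (t : R) (k : nat) (x : R) : Prop :=
  exists2 h, `|h| <= 1 & F (x + h) < F x + g x * h - 4 ^+ k * h ^+ 2 - t ^+ 2.

Lemma supergradient_nincr (R : realType) (F g : R -> R) (u v : R) :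
  is_supergradient F g -> -2 <= u -> u <= v -> v <= 2 -> g v <= g u.
Proof.
move=> gP; rewrite (le_eqVlt u) => u2 /predU1P[-> //|uv] v2.
have H1 : F v <= F u + g u * (v - u) by apply: gP; lra.
have H2 : F u <= F v + g v * (u - v) by apply: gP; lra.
by rewrite -(ler_pM2r (x := v - u)) ?subr_gt0 //; lra.
Qed.

(** Adding the supergradient inequality at [x + h] gives [4^k h^2 + t^2 <= (g x - g (x + h)) h].
    Dropping [t^2] yields the first bound, and the inequality of arithmetic and geometric means the
    second. *)
Lemma steep_drop (R : realType) (F g : R -> R) (t : R) k x :
  is_supergradient F g -> 0 < t -> -1 <= x <= 1 -> steep F g t k x ->
  exists a b, [/\ -2 <= a, a <= x <= b, b <= 2 &
    4 ^+ k * (b - a) <= g a - g b /\ 2 * 2 ^+ k * t <= g a - g b].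
Proof.
move=> gP t0 x1 [h]; rewrite ler_norml => h1.
have Fh : F x <= F (x + h) + g (x + h) * (x - (x + h)) by apply: gP; lra.
rewrite exp4E.
set T : R := 2 ^+ k; have T0 : 0 < T by rewrite exprn_gt0.
move=> lt.
have key : (T * h) ^+ 2 + t ^+ 2 <= (g x - g (x + h)) * h by nra.
have aux (l D : R) : 0 < l -> (T * l) ^+ 2 + t ^+ 2 <= D * l ->
    T ^+ 2 * l <= D /\ 2 * T * t <= D.
  move=> l0 H; rewrite -!(ler_pM2r l0 _ D); split; first by nra.
  by apply: le_trans H; have := sqr_ge0 (T * l - t); lra.
have [h0|h0|h0] := ltgtP h 0.
- exists (x + h), x; split; [lra|lra|lra|].
  by apply: aux; [lra|apply: le_trans (_ : _ <= (g x - g (x + h)) * h) _; lra].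
- exists x, (x + h); split; [lra|lra|lra|].
  by apply: aux; [lra|apply: le_trans (_ : _ <= (g x - g (x + h)) * h) _; lra].
- by move: key; rewrite h0 !mulr0 expr0n /= add0r; nra.
Qed.

(** One steep point is kept from each cell of width [d] that has one, and [vitali_count] with
    [G = - g] counts the cells. The spacing uses [k.+1] because points steep at level [k] are served
    at the next level. *)
Lemma steep_net (R : realType) (F g : R -> R) (L w e : R) (n k : nat) :
  0 < w -> 0 < e -> (0 < n)%N -> is_supergradient F g ->
  (forall x, -2 <= x <= 2 -> `|g x| <= L) ->
  exists s : seq R,
  [/\ (size s)%:R <= (6 / e + w^-1) * (n%:R / 2 ^+ k) * (2 * L),
      (forall y, y \in s -> -1 <= y <= 1) &
      forall x, -1 <= x <= 1 -> steep F g (w / n%:R) k x ->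
      exists2 y, y \in s & `|x - y| <= e / (n%:R * 2 ^+ k.+1)].
Proof.
move=> w0 e0 n0 gP gL.
have n0' : (0 : R) < n%:R by rewrite ltr0n.
set T : R := 2 ^+ k; have T0 : 0 < T by rewrite exprn_gt0.
set d := e / (n%:R * 2 ^+ k.+1); have d0 : 0 < d.
  by rewrite divr_gt0 // mulr_gt0 // exprn_gt0.
pose cell i := [set x : R | [/\ -1 <= x <= 1, steep F g (w / n%:R) k x &
  -1 + i%:R * d <= x <= -1 + i.+1%:R * d]].
pose N := (Num.truncn (2 / d)).+1.
pose idx := [seq i <- iota 0 N | `[< cell i !=set0 >]].
pose X i := xget 0 (cell i).
have XP i : i \in idx -> cell i (X i).
  by rewrite mem_filter => /andP[/asboolP[y yP] _]; exact: (xgetPex 0 (ex_intro _ y yP)).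
have w_n : 0 < w / n%:R by rewrite divr_gt0.
exists (map X idx); split.
- pose P i (ab : R * R) := [/\ -2 <= ab.1, ab.1 <= X i <= ab.2, ab.2 <= 2 &
    4 ^+ k * (ab.2 - ab.1) <= g ab.1 - g ab.2 /\
    2 * T * (w / n%:R) <= g ab.1 - g ab.2].
  have [ab abP] : {ab : nat -> R * R & forall i, i \in idx -> P i (ab i)}.
    apply: (@choice _ _ (fun i ab => i \in idx -> P i ab)) => i; have [/XP[X1 sX _]|ni] := boolP (i \in idx); last by exists (0, 0).
    by have [a [b H]] := steep_drop gP w_n X1 sX; exists (a, b).
  rewrite size_map.
  pose C := (6 / e + w^-1) * (n%:R / T).
  have C0 : 0 <= C.
    by rewrite mulr_ge0 ?addr_ge0 ?divr_ge0 ?invr_ge0 // ltW.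
  have := @vitali_count R (fun x => - g x) X (fun i => (ab i).1) (fun i => (ab i).2)
    (-1) d C (-2) 2 idx d0 C0.
  have gB : - g 2 - - g (-2) <= 2 * L.
    have := gL 2; have := gL (-2); rewrite !ler_norml.
    by move=> /(_ ltac:(lra)) ? /(_ ltac:(lra)) ?; lra.
  move=> H; apply: le_trans (ler_wpM2l C0 gB); apply: H.
  + lra.
  + by move=> u v ? ? ?; rewrite lerN2; apply: (supergradient_nincr gP).
  + by rewrite filter_uniq // iota_uniq.
  move=> i ii; have [_ _ ci] := XP i ii; have [? ? ? [H1 H2]] := abP i ii.
  split=> //; rewrite opprK [- _ + _]addrC.
  set D := g _ - g _ in H1 H2 *; set l := (ab i).2 - (ab i).1 in H1 *.
  have E4 : 4 ^+ k = T ^+ 2 by exact: exp4E.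
  (* The two bounds of [steep_drop] pay separately for the terms [3 l / d] and [2] required by
     [vitali_count]. *)
  have Hl : 3 * l / d <= 6 / e * (n%:R / T) * D.
    have -> : 3 * l / d = 6 / e * (n%:R / T) * (4 ^+ k * l).
      by rewrite /d exprS -/T E4; field; rewrite !gt_eqF.
    by rewrite ler_wpM2l // mulr_ge0 ?divr_ge0 // ltW.
  have H2' : 2 <= w^-1 * (n%:R / T) * D.
    have -> : 2 = w^-1 * (n%:R / T) * (2 * T * (w / n%:R)) by field; rewrite !gt_eqF.
    by rewrite ler_wpM2l // mulr_ge0 ?divr_ge0 ?invr_ge0 // ltW.
  by rewrite /C; lra.
- by move=> _ /mapP[i /XP[? _ _] ->].
- move=> x x1 sx; pose i := Num.truncn ((x + 1) / d).
  have q0 : 0 <= (x + 1) / d by rewrite divr_ge0 ?(ltW d0) //; lra.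
  have /andP[i1 i2] := truncn_itv q0.
  rewrite -/i ler_pdivlMr // in i1; rewrite -/i ltr_pdivrMr // in i2.
  have cx : cell i x by split=> //; lra.
  have ii : i \in idx.
    rewrite mem_filter; apply/andP; split; first by apply/asboolP; exists x.
    rewrite mem_iota add0n ltnS /= truncn_ge_nat; last by rewrite divr_ge0 ?(ltW d0).
    by rewrite ler_pdivlMr //; lra.
  exists (X i); first exact: map_f.
  have [_ _] := XP i ii; rewrite -natr1 in i2 *.
  by rewrite ler_norml; lra.
Qed.

Lemma geometric_half_le2 (R : realType) (K : nat) :
  \sum_(k < K) (2 ^+ k)^-1 <= 2 :> R.
Proof.
suff -> : \sum_(k < K) (2 ^+ k)^-1 = 2 - 2 / 2 ^+ K :> R.
  by rewrite gerBl divr_ge0 ?exprn_ge0.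
elim: K => [|K IH]; first by rewrite big_ord0 expr0; lra.
by rewrite big_ord_recr /= IH exprS; field; rewrite expf_neq0.
Qed.

Lemma concave_net (R : realType) (L w e : R) : 0 <= L -> 0 < w -> 0 < e ->
  exists2 C : R, 0 <= C & forall (F g : R -> R) (n : nat),
  (0 < n)%N -> is_supergradient F g ->
  (forall x, -2 <= x <= 2 -> `|g x| <= L) ->
  exists s : seq R,
  [/\ (size s)%:R <= C * n%:R, (forall y, y \in s -> -1 <= y <= 1) &
      forall x, -1 <= x <= 1 -> exists2 y, y \in s &
      exists2 k, `|x - y| <= e / (n%:R * 2 ^+ k) & ~ steep F g (w / n%:R) k x].
Proof.
move=> L0 w0 e0; pose C1 := (6 / e + w^-1) * (2 * L).
have C10 : 0 <= C1 by rewrite !mulr_ge0 ?addr_ge0 ?divr_ge0 ?invr_ge0 // ltW.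
have e_inv0 : 0 <= 2 / e by rewrite divr_ge0 // ltW.
exists (2 / e + 1 + 2 * C1); first by lra.
move=> F g n n0 gP gL; have n0' : (0 : R) < n%:R by rewrite ltr0n.
have n1 : (1 : R) <= n%:R by rewrite ler1n.
have [s sP] := choice (fun k => @steep_net R F g L w e n k w0 e0 n0 gP gL).
pose K := (Num.truncn (L * n%:R / w)).+1.
pose d := e / n%:R; have d0 : 0 < d by rewrite divr_gt0.
pose N := Num.truncn (2 / d).
have q0 : 0 <= 2 / d by rewrite divr_ge0 // ltW.
pose base := [seq -1 + i%:R * d | i <- iota 0 N.+1].
(* Since [2^K] exceeds [L n / w], one has [(T h)^2 + t^2 >= 2 T t |h| >= 2 L |h|], more than the
   slope can drop; so only levels below [K] matter. *)
have not_steep x : -1 <= x <= 1 -> ~ steep F g (w / n%:R) K x.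
  move=> x1 [h]; rewrite ler_norml => h1.
  have Fh : F x <= F (x + h) + g (x + h) * (x - (x + h)) by apply: gP; lra.
  rewrite exp4E.
  set T : R := 2 ^+ K; set t := w / n%:R.
  have LT : L <= T * t.
    have : L * n%:R / w <= T.
      apply: (@le_trans _ _ K%:R); first by rewrite ltW // truncnS_gt.
      by rewrite /T -natrX ler_nat ltnW // ltn_expl.
    by rewrite ler_pdivrMr // /t mulrA ler_pdivlMr.
  have := gL x; have := gL (x + h); rewrite !ler_norml.
  move=> /(_ ltac:(lra)) g1 /(_ ltac:(lra)) g2.
  have le1 : (g x - g (x + h)) * h <= 2 * (T * t) * `|h|.
    by rewrite (le_trans (ler_norm _)) // normrM ler_wpM2r // ler_norml; lra.
  have := sqr_ge0 (T * `|h| - t); rewrite sqrrB exprMn real_normK ?num_real //.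
  by lra.
exists (base ++ flatten [seq s k | k <- iota 0 K]); split.
- rewrite size_cat size_map size_iota natrD -natr1 size_flatten /shape -map_comp.
  rewrite sumnE big_map natr_sum -/(index_iota 0 K) big_mkord.
  have H1 : N%:R <= 2 / e * n%:R.
    apply: (@le_trans _ _ (2 / d)); first by rewrite truncn_le.
    by rewrite /d invf_div mulrA mulrAC.
  have H2 : \sum_(k < K) ((size (s k))%:R : R) <= 2 * C1 * n%:R.
    apply: (@le_trans _ _ (C1 * n%:R * \sum_(k < K) (2 ^+ k)^-1)).
      rewrite mulr_sumr; apply: ler_sum => k _; have [H _ _] := sP k.
      by apply: le_trans H _; rewrite /C1; lra.
    have := geometric_half_le2 R K; have : 0 <= C1 * n%:R by rewrite mulr_ge0.
    by move=> c0 s2; have := ler_wpM2l c0 s2; lra.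
  by rewrite /= !mulrDl mul1r; lra.
- move=> y; rewrite mem_cat => /orP[/mapP[i] | /flattenP[_ /mapP[k _ ->] ys]].
    rewrite mem_iota add0n ltnS /= truncn_ge_nat // ler_pdivlMr // => iN ->.
    have id0 : 0 <= i%:R * d by rewrite mulr_ge0 // ltW.
    by lra.
  by have [_ H _] := sP k; exact: H.
- move=> x x1.
  have ex : exists k, `[< ~ steep F g (w / n%:R) k x >].
    by exists K; apply/asboolP/not_steep.
  (* Take the least non-steep level. Level 0 is served by the equispaced [base]; level [k.+1] by
     [s k], as [x] is steep at level [k]. *)
  have [[|k] /asboolP kP kmin] := ex_minnP ex.
    pose i := Num.truncn ((x + 1) / d).
    have q1 : 0 <= (x + 1) / d by rewrite divr_ge0 ?(ltW d0) //; lra.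
    have /andP[i1 i2] := truncn_itv q1.
    rewrite -/i ler_pdivlMr // in i1; rewrite -/i ltr_pdivrMr // -natr1 in i2.
    exists (-1 + i%:R * d).
      rewrite mem_cat; apply/orP; left; apply/mapP; exists i => //.
      by rewrite mem_iota add0n ltnS /= truncn_ge_nat // ler_pdivlMr //; lra.
    by exists 0%N => //; rewrite expr0 mulr1 -/d ler_norml; lra.
  have sk : steep F g (w / n%:R) k x.
    by apply: contrapT => /asboolP/kmin; rewrite ltnn.
  have [_ _ /(_ x x1 sk)[y ys xy]] := sP k; exists y; last by exists k.+1.
  rewrite mem_cat; apply/orP; right; apply/flattenP; exists (s k) => //.
  apply: map_f; rewrite mem_iota add0n /=.
  by have := kmin K; move/(_ (asboolT (not_steep x x1))).
Qed.

(** * Comparison of polynomial values near the graph *)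

(** Abstracts a bivariate polynomial of total degree at most [n] through its restrictions to
    polynomial curves; this form passes to affine charts and to rescalings of [z]. *)
Definition poly_on_curves (R : realType) (n : nat) (P : R -> R -> R) : Prop :=
  forall d (S Z : {poly R}), (size S <= d.+1)%N -> (size Z <= d.+1)%N ->
  exists2 q : {poly R}, (size q <= (d * n).+1)%N &
    forall t, P S.[t] Z.[t] = q.[t].

Lemma size_deg1 (R : realType) (a b : R) : (size (a%:P + b *: 'X)%R <= 2)%N.
Proof.
rewrite (leq_trans (size_polyD _ _)) // geq_max.
rewrite (leq_trans (size_polyC_leq1 _)) //=.
by rewrite (leq_trans (size_scale_leq _ _)) // size_polyX.
Qed.

Lemma size_deg2 (R : realType) (a b c : R) :
  (size (a%:P + b *: 'X + c *: 'X^2)%R <= 3)%N.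
Proof.
rewrite (leq_trans (size_polyD _ _)) // geq_max.
rewrite (leq_trans (size_deg1 _ _)) //=.
by rewrite (leq_trans (size_scale_leq _ _)) // size_polyXn.
Qed.

(** Apply [bernstein_end] to the vertical segment, parametrised from its top by [f - f * t]; since
    [f >= 1], the relative depth [dl / f] is at most [(r / n)^2]. *)
Lemma vertical_compare (R : realType) (n : nat) (P : R -> R -> R)
    (M s f r dl : R) :
  (0 < n)%N -> poly_on_curves n P -> 1 <= f ->
  (forall z, 0 <= z <= f -> `|P s z| <= M) ->
  0 <= r <= 2^-1 -> 0 <= dl <= (r / n%:R) ^+ 2 ->
  `|P s (f - dl) - P s f| <= 8 * r * M.
Proof.
move=> n0 Pn f1 PM /andP[r0 r12] /andP[dl0 dlr].
have n0' : (0 : R) < n%:R by rewrite ltr0n.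
have n1 : (1 : R) <= n%:R by rewrite ler1n.
have M0 : 0 <= M by apply: le_trans (PM 0 _); rewrite ?normr_ge0 //; lra.
have sC : (size (s%:P)%R <= 2)%N := leqW (size_polyC_leq1 s).
have [q] := Pn 1%N _ _ sC (size_deg1 f (- f)).
rewrite mul1n => sq qE.
have {}qE t : q.[t] = P s (f - f * t).
  by rewrite -qE hornerC hornerD hornerZ hornerX hornerC; congr (P _ _); lra.
have f0 : 0 < f by lra.
pose u := Num.sqrt (dl / f); have u0 : 0 <= u by exact: sqrtr_ge0.
have u2 : u ^+ 2 = dl / f by rewrite sqr_sqrtr // divr_ge0 // ltW.
have rn0 : 0 <= r / n%:R by rewrite divr_ge0 // ltW.
have ur : u <= r / n%:R.
  rewrite -(ler_pXn2r (n := 2)) // ?nnegrE //; rewrite u2.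
  by apply: le_trans dlr; rewrite ler_pdivrMr //; nra.
have rn : r / n%:R <= r by rewrite ler_pdivrMr //; nra.
have := @bernstein_end R n q M u n0 sq _ _.
rewrite !qE u2 mulr0 subr0 [f * _]mulrC divfK ?gt_eqF //.
rewrite ger0_norm // => H; apply: le_trans (H _ _) _; last 1 first.
- have -> : 8 * r * M = 8 * n%:R * M * (r / n%:R) by field; rewrite gt_eqF.
  by rewrite ler_wpM2l // !mulr_ge0 // ltW.
- by move=> x x01; rewrite qE; apply: PM; nra.
- lra.
Qed.

(* The parabola attached to [x] is a curve of degree 2 inside the domain along
   which Bernstein's inequality costs at most [8 w M = M / 16]; the vertical
   segments from its points [x] and [y] up to the graph cost at most
   [8 w M = M / 16] and [16 w M = M / 8]. *)
Lemma boundary_compare (R : realType) (L : R) (F g : R -> R) (n k : nat)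
    (P : R -> R -> R) (M x y : R) (w := 128^-1 : R) (eta := (4 * (L + 1))^-1 : R) :
  0 <= L -> (0 < n)%N -> poly_on_curves n P -> is_supergradient F g ->
  (forall s, -2 <= s <= 2 -> `|g s| <= L) ->
  (forall s, -2 <= s <= 2 -> 1 <= F s) ->
  (forall s z, -2 <= s <= 2 -> 0 <= z <= F s -> `|P s z| <= M) ->
  -1 <= x <= 1 -> -1 <= y <= 1 -> `|x - y| <= eta * w / (n%:R * 2 ^+ k) ->
  ~ steep F g (w / n%:R) k x ->
  `|P x (F x) - P y (F y)| <= M / 4.
Proof.
move=> L0 n0 Pn gP gL F1 PM x1 y1 xy nst.
have n0' : (0 : R) < n%:R by rewrite ltr0n.
have n1 : (1 : R) <= n%:R by rewrite ler1n.
have M0 : 0 <= M.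
  by apply: le_trans (PM x 0 _ _); rewrite ?normr_ge0 ?lexx ?(le_trans _ (F1 x _)) //; lra.
have w0 : 0 < w by rewrite /w; lra.
have w_def : w * 128 = 1 by rewrite /w; lra.
have eta0 : 0 < eta by rewrite invr_gt0; lra.
have eta_def : eta * (4 * (L + 1)) = 1 by rewrite mulVf // gt_eqF //; lra.
have T1 : 1 <= 2 ^+ k :> R by rewrite exprn_ege1 //; lra.
set T := 2 ^+ k in T1 xy; have T0 : 0 < T by lra.
pose t := w / n%:R; have t0 : 0 < t by rewrite divr_gt0.
have tw : t <= w by rewrite ler_pdivrMr //; nra.
rewrite -/t in nst.
(* The parabola is run over [h = a u] with [u] in [[-1, 1]]; then [T h = eta u], and [eta] is small
   enough to keep the parabola above 0, as [F >= 1] and [L eta <= 1/4]. *)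
pose a := eta / T; have a0 : 0 < a by rewrite divr_gt0.
have Ta : T * a = eta by rewrite /a mulrC divfK // gt_eqF.
have ae : a <= eta by nra.
have Feta : eta <= 4^-1 by nra.
have Leta : L * eta <= 4^-1 by nra.
pose th := (y - x) / a.
have xyE : a * th = y - x by rewrite /th mulrC divfK // gt_eqF.
have tht : `|th| <= t.
  rewrite /th normrM normfV (gtr0_norm a0) ler_pdivrMr // distrC (le_trans xy) //.
  by rewrite le_eqVlt /t /a; apply/orP; left; apply/eqP; field; rewrite !gt_eqF.
pose S := x%:P + a *: 'X.
pose Z := (F x - t ^+ 2)%:P + (g x * a) *: 'X + (- eta ^+ 2) *: 'X^2.
have SE u : S.[u] = x + a * u by rewrite /S hornerD hornerC hornerZ hornerX.
have ZE u : Z.[u] = F x - t ^+ 2 + g x * (a * u) - (T * (a * u)) ^+ 2.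
  have -> : T * (a * u) = eta * u by rewrite mulrA Ta.
  by rewrite /Z !hornerD hornerC !hornerZ hornerX hornerXn; ring.
have nst' h : `|h| <= 1 -> F x - t ^+ 2 + g x * h - (T * h) ^+ 2 <= F (x + h).
  move=> h1; rewrite leNgt; apply/negP => lt; apply: nst; exists h => //.
  by rewrite exp4E -/T; apply: lt_le_trans lt _; lra.
have gx : `|g x| <= L by apply: gL; lra.
have Z_itv u : `|u| <= 1 -> 0 <= Z.[u] <= F S.[u].
  move=> u1; rewrite ZE SE nst'; last first.
    by rewrite normrM (gtr0_norm a0); nra.
  have -> : T * (a * u) = eta * u by rewrite mulrA Ta.
  rewrite andbT.
  have Fx : 1 <= F x by apply: F1; lra.
  have : `|g x * (a * u)| <= 4^-1.
    rewrite normrM (le_trans _ Leta) // ler_pM // normrM (gtr0_norm a0); nra.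
  rewrite ler_norml => gau.
  have : (eta * u) ^+ 2 <= 16^-1.
    have : `|eta * u| <= 4^-1 by rewrite normrM (gtr0_norm eta0); nra.
    by rewrite ler_norml; nra.
  have : t ^+ 2 <= 16^-1 by nra.
  lra.
have S2 u : `|u| <= 1 -> -2 <= S.[u] <= 2.
  move=> u1; have : `|a * u| <= 1 by rewrite normrM (gtr0_norm a0); nra.
  by rewrite SE ler_norml; lra.
have [q sq qE] := Pn 2 S Z (leqW (size_deg1 _ _)) (size_deg2 _ _ _).
have th1 : `|th| <= 2^-1 by lra.
have th1' : `|th| <= 1 by lra.
have H1 : `|P y Z.[th] - P x Z.[0]| <= M / 16.
  have := @bernstein_center R (2 * n) q M th _ sq _ th1.
  rewrite -!qE !SE mulr0 addr0 xyE [x + _]addrC subrK => H.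
  apply: le_trans (H _ _) _; first by rewrite muln_gt0.
    move=> u; rewrite -ler_norml => u1; rewrite -qE; apply: PM; [exact: S2|exact: Z_itv].
  apply: (@le_trans _ _ (4 * (2 * n)%:R * M * t)); first by rewrite ler_wpM2l ?mulr_ge0.
  rewrite /t natrM le_eqVlt; apply/orP; left; apply/eqP.
  by rewrite /w; field; rewrite gt_eqF.
have H2 : `|P x Z.[0] - P x (F x)| <= M / 16.
  have -> : Z.[0] = F x - t ^+ 2 by rewrite ZE !mulr0 expr0n /=; lra.
  have -> : M / 16 = 8 * w * M by rewrite /w; lra.
  apply: (vertical_compare n0 Pn); [apply: F1; lra| |lra|].
    by move=> z; apply: PM; lra.
  by rewrite -/t lexx sqr_ge0.
have H3 : `|P y Z.[th] - P y (F y)| <= M / 8.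
  have -> : Z.[th] = F y - (F y - Z.[th]) by lra.
  have -> : M / 8 = 8 * (2 * w) * M by rewrite /w; lra.
  apply: (vertical_compare n0 Pn); [apply: F1; lra| |lra|].
    by move=> z; apply: PM; lra.
  have := Z_itv th th1'; rewrite SE xyE [x + _]addrC subrK => /andP[_ Zy].
  (* The supergradient bounds [F y] by the tangent at [x], so the gap to the parabola is at most
     [t^2 + (eta th)^2 <= (2 t)^2]. *)
  rewrite subr_ge0 Zy /= ZE xyE.
  have := gP x y; move/(_ ltac:(lra) ltac:(lra)) => gxy.
  have -> : 2 * w / n%:R = 2 * t by rewrite /t mulrA.
  have : (T * (y - x)) ^+ 2 <= t ^+ 2.
    rewrite -xyE mulrA Ta exprMn -[th ^+ 2]real_normK ?num_real //.
    have : `|th| ^+ 2 <= t ^+ 2 by rewrite ler_pXn2r // nnegrE ?(ltW t0).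
    have : 0 <= `|th| ^+ 2 by rewrite sqr_ge0.
    have : eta ^+ 2 <= 1 by nra.
    by nra.
  by have := sqr_ge0 t; lra.
have -> : P x (F x) - P y (F y) = - (P x Z.[0] - P x (F x)) - (P y Z.[th] - P x Z.[0])
  + (P y Z.[th] - P y (F y)) by ring.
rewrite (le_trans (ler_normD _ _)) //.
have := ler_normB (- (P x Z.[0] - P x (F x))) (P y Z.[th] - P x Z.[0]).
by rewrite normrN; lra.
Qed.

(** The supremum of the chord slopes to the right of [x] works: by concavity every chord slope to
    the left bounds them from above. *)
Lemma supergradient_exists (R : realType) (F : R -> R) (x : R) :
  (forall a b l, -4 <= a <= 4 -> -4 <= b <= 4 -> 0 <= l <= 1 ->
     l * F a + (1 - l) * F b <= F (l * a + (1 - l) * b)) ->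
  -4 < x < 4 ->
  exists g, forall y, -4 <= y <= 4 -> F y <= F x + g * (y - x).
Proof.
move=> Fc x4.
have slopes z y : -4 <= z -> z < x -> x < y -> y <= 4 ->
    (F y - F x) / (y - x) <= (F x - F z) / (x - z).
  move=> z4 zx xy y4.
  pose l := (y - x) / (y - z).
  have yz : 0 < y - z by lra.
  have lE : l * (y - z) = y - x by rewrite /l divfK // gt_eqF.
  have l01 : 0 <= l <= 1.
    by rewrite /l divr_ge0 ?ler_pdivrMr //; lra.
  have := @Fc z y l; move=> /(_ ltac:(lra) ltac:(lra) l01).
  have -> : l * z + (1 - l) * y = x by lra.
  move=> H; rewrite ler_pdivrMr ?subr_gt0 // mulrAC ler_pdivlMr ?subr_gt0 //.
  have : (l * F z + (1 - l) * F y) * (y - z) <= F x * (y - z) by rewrite ler_wpM2r // ltW.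
  have -> : (l * F z + (1 - l) * F y) * (y - z) =
     (l * (y - z)) * F z + ((y - z) - l * (y - z)) * F y by ring.
  by rewrite lE; lra.
pose A := [set (F y - F x) / (y - x) | y in [set y | x < y <= 4]].
have ubA z : -4 <= z -> z < x -> ubound A ((F x - F z) / (x - z)).
  by move=> z4 zx _ [y /= /andP[? ?] <-]; exact: slopes.
have A0 : A !=set0 by exists ((F 4 - F x) / (4 - x)), 4 => //=; lra.
have hA : has_ubound A.
  by exists ((F x - F (-4)) / (x - -4)); apply: ubA; lra.
exists (sup A) => y y4; have [yx|xy|->] := ltgtP y x; last by rewrite subrr mulr0 addr0.
- have : sup A <= (F x - F y) / (x - y) by apply: ge_sup => //; apply: ubA; lra.
  by rewrite ler_pdivlMr ?subr_gt0 //; lra.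
- have : (F y - F x) / (y - x) <= sup A.
    by apply: ub_le_sup => //; exists y => //=; lra.
  by rewrite ler_pdivrMr ?subr_gt0 //; lra.
Qed.

(** * Meshes in a chart *)

Lemma peval_curve (R : realType) (n d : nat) (p : mpoly.mpoly 2 R)
    (c : 'I_2 -> {poly R}) :
  Pi2 n p -> (forall i, (size (c i) <= d.+1)%N) ->
  exists2 q : {poly R}, (size q <= (d * n).+1)%N &
    forall t, peval p (\row_i (c i).[t]) = q.[t].
Proof.
rewrite /Pi2 /= => pn cd.
exists (\sum_(m <- mpoly.msupp p) mpoly.mcoeff m p *: \prod_i c i ^+ (mpoly.fun_of_multinom m i)).
  rewrite big_seq; apply: (big_ind (fun q : {poly R} => (size q <= (d * n).+1)%N)).
  - by rewrite size_poly0.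
  - by move=> q1 q2 s1 s2; rewrite (leq_trans (size_polyD _ _)) // geq_max s1.
  move=> m /(mpoly.mmeasure_mnm_lt mpoly.mdeg) mp.
  rewrite (leq_trans (size_scale_leq _ _)) //.
  have mn : (mpoly.mdeg m <= n)%N by rewrite -ltnS (leq_trans mp).
  apply: (@leq_trans (d * mpoly.mdeg m).+1); last by rewrite ltnS leq_mul2l mn orbT.
  rewrite mpoly.mdegE big_distrr /=.
  apply: (big_ind2 (fun (q : {poly R}) k => (size q <= k.+1)%N)).
  - exact: size_polyC_leq1.
  - move=> q1 k1 q2 k2 s1 s2; rewrite (leq_trans (size_polyMleq _ _)) //.
    by case: (size q1) (size q2) s1 s2 => [|a] [|b]; lia.
  - move=> i _; rewrite (leq_trans (size_poly_exp_leq _ _)) // ltnS leq_mul2r.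
    by apply/orP; right; case: (size (c i)) (cd i).
move=> t; rewrite /peval mpoly.mevalE horner_sum; apply: eq_bigr => m _.
rewrite hornerZ horner_prod; congr (_ * _); apply: eq_bigr => i _.
by rewrite horner_exp mxE.
Qed.

Definition chart (R : realType) (o e v : 'rV[R]_2) (s z : R) : 'rV[R]_2 :=
  o + s *: e + z *: v.

Lemma chart_poly_on_curves (R : realType) (n : nat) (p : mpoly.mpoly 2 R)
    (o e v : 'rV[R]_2) :
  Pi2 n p -> poly_on_curves n (fun s z => peval p (chart o e v s z)).
Proof.
move=> pn d S Z sS sZ.
pose c i := (o ord0 i)%:P + (e ord0 i) *: S + (v ord0 i) *: Z.
have [|q sq qE] := @peval_curve R n d p c pn.
  move=> i; rewrite (leq_trans (size_polyD _ _)) // geq_max.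
  rewrite (leq_trans (size_polyD _ _)) ?geq_max; last first.
    by rewrite (leq_trans (size_polyC_leq1 _)) //= (leq_trans (size_scale_leq _ _)).
  by rewrite (leq_trans (size_scale_leq _ _)).
exists q => // t; rewrite -qE; congr peval; apply/rowP => i.
by rewrite !mxE /c !hornerD !hornerZ hornerC [S.[t] * _]mulrC [Z.[t] * _]mulrC.
Qed.

Lemma convex_setE (R : realType) (D : set 'rV[R]_2) (x y : 'rV[R]_2) (l : R) :
  convex_set D -> D x -> D y -> 0 <= l <= 1 -> D (l *: x + (1 - l) *: y).
Proof.
move=> Dc Dx Dy /andP[l0 l1].
by have := Dc x y (Itv01 l0 l1); rewrite !inE; apply.
Qed.

Lemma chart_conv (R : realType) (o e v : 'rV[R]_2) (s z s' z' l : R) :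
  l *: chart o e v s z + (1 - l) *: chart o e v s' z' =
  chart o e v (l * s + (1 - l) * s') (l * z + (1 - l) * z').
Proof. by apply/rowP => i; rewrite !mxE; ring. Qed.

Lemma closed_chart_fiber (R : realType) (D : set 'rV[R]_2) (o e v : 'rV[R]_2) (s : R) :
  compact D -> closed [set z | D (chart o e v s z)].
Proof.
move=> cD; apply: (@preimage_closed _ _ (fun z => chart o e v s z) D).
  move=> z _; apply: cvgD; first exact: cvg_cst.
  by apply: cvgZr_tmp; exact: cvg_id.
by apply: compact_closed cD; exact: norm_hausdorff.
Qed.

(* For [A = D] this gives an optimal mesh: [M <= max_Y |p| + M / 2] for the
   maximum [M] of [|p|] on [D]. *)
Definition half_mesh (R : realType) (D A : set 'rV[R]_2) : Prop :=
  exists2 C : R, 0 <= C & forall n, (0 < n)%N -> exists Y : seq 'rV[R]_2,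
  [/\ (size Y)%:R <= C * n%:R ^+ 2, (forall y, y \in Y -> D y) &
    forall p M, Pi2 n p -> (forall x, D x -> `|peval p x| <= M) ->
    forall x, A x -> exists2 y, y \in Y & `|peval p x - peval p y| <= M / 2].

(* Below the graph of [F], first move along the vertical line to one of the
   [O(n)] levels [z = r F], then along that level: [(s, z) -> (s, r z)] maps the
   region below the graph into itself, so the estimate on the graph applies. *)
Lemma chart_mesh (R : realType) (D : set 'rV[R]_2) (o e v : 'rV[R]_2) (L : R) :
  convex_set D -> compact D -> 0 <= L ->
  (forall s z, -4 <= s <= 4 -> 0 <= z <= 1 -> D (chart o e v s z)) ->
  (forall s z, -4 <= s <= 4 -> D (chart o e v s z) -> z <= L) ->
  half_mesh D [set x | D x /\ exists s z, [/\ -1 <= s <= 1, 0 <= z & x = chart o e v s z]].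
Proof.
move=> Dc cD L0 Dbox DL.
pose pt := chart o e v.
pose A s := [set z | D (pt s z)].
pose F s := sup (A s).
have A1 s : -4 <= s <= 4 -> A s 1 by move=> ?; apply: Dbox => //; lra.
have Aub s : -4 <= s <= 4 -> has_ubound (A s).
  by move=> s4; exists L => z Dz; exact: DL Dz.
have FD s : -4 <= s <= 4 -> D (pt s (F s)).
  move=> s4; have : closure (A s) (F s).
    by apply: closure_sup; [exists 1; exact: A1|exact: Aub].
  by rewrite -(proj1 (closure_id _)) //; exact: closed_chart_fiber.
have leF s z : -4 <= s <= 4 -> D (pt s z) -> z <= F s.
  by move=> s4 Dz; apply: ub_le_sup => //; exact: Aub.
have F1 s : -4 <= s <= 4 -> 1 <= F s by move=> s4; apply: leF => //; exact: A1.
have FL s : -4 <= s <= 4 -> F s <= L by move=> s4; exact: DL (FD s s4).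
have underF s z : -4 <= s <= 4 -> 0 <= z <= F s -> D (pt s z).
  move=> s4 z01; have Fs := F1 s s4; have Fs0 : F s != 0 by rewrite gt_eqF //; lra.
  have := @convex_setE R D (pt s (F s)) (pt s 0) (z / F s) Dc (FD s s4).
  rewrite chart_conv mulr0 addr0 divfK // -mulrDl addrC subrK mul1r; apply.
    by apply: Dbox => //; lra.
  by rewrite divr_ge0 ?ler_pdivrMr; lra.
have Fconc a b l : -4 <= a <= 4 -> -4 <= b <= 4 -> 0 <= l <= 1 ->
     l * F a + (1 - l) * F b <= F (l * a + (1 - l) * b).
  move=> a4 b4 l1; apply: leF; first by nra.
  by rewrite /pt -chart_conv; apply: convex_setE => //; exact: FD.
(* Outside [-4 < x < 4] the value 0 is a dummy. *)
have [g0 g0P] := @choice _ _ (fun x g => -4 < x < 4 -> forall y, -4 <= y <= 4 ->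
    F y <= F x + g * (y - x)) (fun x => match pselect (-4 < x < 4) with
    | left H => let: ex_intro g P := supergradient_exists Fconc H in
       ex_intro _ g (fun=> P)
    | right H => ex_intro _ 0 (fun H' => False_ind _ (H H')) end).
have gP : is_supergradient F g0 by move=> x y x2 y2; apply: g0P; lra.
have gL x : -2 <= x <= 2 -> `|g0 x| <= L.
  move=> x2.
  (* The margin between [[-2, 2]] and [[-4, 4]] bounds the slope: [F] stays between 1 and [L] at
     distance 2 on both sides. *)
  have H1 : F (x + 2) <= F x + g0 x * (x + 2 - x) by apply: g0P; lra.
  have H2 : F (x - 2) <= F x + g0 x * (x - 2 - x) by apply: g0P; lra.
  have H3 : 1 <= F (x + 2) by apply: F1; lra.
  have H4 : 1 <= F (x - 2) by apply: F1; lra.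
  have H5 : F x <= L by apply: FL; lra.
  by rewrite ler_norml; lra.
pose w : R := 128^-1; pose eta := (4 * (L + 1))^-1.
have w0 : 0 < w by rewrite /w; lra.
have eta0 : 0 < eta by rewrite invr_gt0; lra.
have [C C0 netP] := concave_net L0 w0 (mulr_gt0 eta0 w0).
exists (C * 33); first by rewrite mulr_ge0.
move=> n n0; have [s [ss s1 sP]] := netP F g0 n n0 gP gL.
exists [seq pt y (cheb_node R n i * F y) | y <- s, i <- iota 0 (33 * n)]; split.
- rewrite size_allpairs size_iota !natrM.
  have -> : C * 33 * n%:R ^+ 2 = C * n%:R * (33 * n%:R) by ring.
  by rewrite ler_wpM2r // mulr_ge0.
- move=> _ /allpairsP[[y i] /= [ys _ ->]]; have y1 := s1 y ys.
  have := cheb_node_itv R n i; have Fy : 1 <= F y by apply: F1; lra.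
  by move=> c01; apply: underF; [lra|nra].
move=> p M pn pM x [Dx [a [z [a1 z0 xE]]]].
have Dz : D (pt a z) by rewrite /pt -xE.
rewrite xE {x xE Dx}.
have a4 : -4 <= a <= 4 by lra.
have Fa := F1 a a4; have Fa0 : F a != 0 by rewrite gt_eqF //; lra.
have Pn := chart_poly_on_curves o e v pn.
have M0 : 0 <= M by exact: le_trans (normr_ge0 _) (pM _ Dz).
have sC : (size (a%:P)%R <= 2)%N := leqW (size_polyC_leq1 a).
have [q] := Pn 1%N _ _ sC (size_deg1 0 (F a)).
rewrite mul1n => sq qE.
have {}qE t : q.[t] = peval p (pt a (t * F a)).
  by rewrite -qE hornerC hornerD hornerZ hornerX hornerC add0r mulrC.
have qM t : 0 <= t <= 1 -> `|q.[t]| <= M.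
  by move=> t1; rewrite qE; apply/pM/underF => //; nra.
have [|i i33 Hi] := @cheb_node_dense R n q M (z / F a) n0 sq qM.
  have zF : z <= F a by exact: leF.
  apply/andP; split; first by rewrite divr_ge0 //; lra.
  by rewrite ler_pdivrMr ?mul1r //; lra.
rewrite !qE divfK // in Hi.
set r := cheb_node R n i in Hi; have r01 : 0 <= r <= 1 := cheb_node_itv R n i.
have [y ys [k ayk nst]] := sP a a1.
exists (pt y (r * F y)); first by apply: allpairs_f => //; rewrite mem_iota.
have Pn' : poly_on_curves n (fun s z => peval p (pt s (r * z))).
  move=> d S Z sS sZ; have sZ' : (size (r *: Z) <= d.+1)%N.
    by rewrite (leq_trans (size_scale_leq _ _)).
  have [q' sq' q'E] := Pn d S _ sS sZ'; exists q' => // t.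
  by rewrite -q'E hornerZ.
have H2 : `|peval p (pt a (r * F a)) - peval p (pt y (r * F y))| <= M / 4.
  apply: (@boundary_compare R L F g0 n k (fun s z => peval p (pt s (r * z))) M a y) => //.
  - by move=> u u2; apply: F1; lra.
  - by move=> u b u2 b1; apply/pM/underF; [lra|nra].
  - exact: s1.
have -> : peval p (chart o e v a z) - peval p (pt y (r * F y)) =
  (peval p (pt a z) - peval p (pt a (r * F a))) +
  (peval p (pt a (r * F a)) - peval p (pt y (r * F y))) by rewrite /pt; ring.
by rewrite (le_trans (ler_normD _ _)) //; lra.
Qed.

(** * Covering the domain by charts *)

Lemma half_mesh_bigcup (R : realType) (D : set 'rV[R]_2) (T : eqType)
    (s : seq T) (A : T -> set 'rV[R]_2) :
  (forall i, i \in s -> half_mesh D (A i)) ->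
  half_mesh D [set x | exists2 i, i \in s & A i x].
Proof.
elim: s => [_|i s IHs sP].
  exists 0 => // n _; exists [::]; split=> //; first by rewrite mul0r.
  by move=> p M _ _ x [].
have [C1 C10 Y1P] := sP i (mem_head _ _).
have [|C2 C20 Y2P] := IHs.
  by move=> j js; apply: sP; rewrite inE js orbT.
exists (C1 + C2) => [|n n0]; first exact: addr_ge0.
have [Y1 [sz1 D1 H1]] := Y1P n n0; have [Y2 [sz2 D2 H2]] := Y2P n n0.
exists (Y1 ++ Y2); split.
- by rewrite size_cat natrD mulrDl lerD.
- by move=> y; rewrite mem_cat => /orP[/D1|/D2].
move=> p M pn pM x [j /[!inE] /predU1P[->|js] Ax].
  have [y yY Hy] := H1 p M pn pM x Ax.
  by exists y; rewrite ?mem_cat ?yY.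
have [|y yY Hy] := H2 p M pn pM x; first by exists j.
by exists y; rewrite ?mem_cat ?yY ?orbT.
Qed.

Lemma half_mesh_subset (R : realType) (D A B : set 'rV[R]_2) :
  A `<=` B -> half_mesh D B -> half_mesh D A.
Proof.
move=> AB [C C0 CP]; exists C => // n n0; have [Y [sz YD H]] := CP n n0.
by exists Y; split=> // p M pn pM x /AB; exact: H.
Qed.

Lemma ord2_cases (i1 i2 i : 'I_2) : i1 != i2 -> i = i1 \/ i = i2.
Proof.
move=> i12; have [->|ii1] := eqVneq i i1; [by left|right; apply: val_inj].
have := ltn_ord i; have := ltn_ord i1; have := ltn_ord i2.
by move: i12 ii1; rewrite -!(inj_eq val_inj) /=; lia.
Qed.

Section Frames.
Context (R : realType) (o : 'rV[R]_2) (a b t sg : R) (i1 i2 : 'I_2).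

Definition frame_e : 'rV[R]_2 := b *: delta_mx ord0 i2.

(** The direction of slope [t] over the axis [i1]; [sg] is a sign choosing the side of [o]. *)
Definition frame_v : 'rV[R]_2 :=
  (sg * a) *: (delta_mx ord0 i1 + t *: delta_mx ord0 i2).

Lemma frame_coord1 s z : i1 != i2 ->
  chart o frame_e frame_v s z ord0 i1 = o ord0 i1 + sg * a * z.
Proof.
by move=> /negPf i12; rewrite /chart /frame_e /frame_v !mxE !eqxx i12 /=; ring.
Qed.

Lemma frame_coord2 s z : i1 != i2 ->
  chart o frame_e frame_v s z ord0 i2 = o ord0 i2 + b * s + sg * a * t * z.
Proof.
move=> /negPf; rewrite eq_sym => i12.
by rewrite /chart /frame_e /frame_v !mxE !eqxx i12 /=; ring.
Qed.

End Frames.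

(** The parameter box moves each coordinate by at most [4 (r / 8) + r / 2 = r], hence stays in [D].
    The [i1] coordinate changes by [r / 2] per unit of [z], so [z] is at most [2 B / r] in [D]. *)
Lemma frame_half_mesh (R : realType) (D : set 'rV[R]_2) (o : 'rV[R]_2)
    (r B t sg : R) (i1 i2 : 'I_2) :
  convex_set D -> compact D -> i1 != i2 -> 0 < r -> 0 <= B -> `|sg| = 1 ->
  -1 <= t <= 1 ->
  (forall x : 'rV[R]_2, (forall i, `|x ord0 i - o ord0 i| <= r) -> D x) ->
  (forall x, D x -> forall i, `|x ord0 i - o ord0 i| <= B) ->
  half_mesh D [set x | D x /\ exists s z, [/\ -1 <= s <= 1, 0 <= z &
    x = chart o (frame_e (r / 8) i2) (frame_v (r / 2) t sg i1 i2) s z]].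
Proof.
move=> Dc cD i12 r0 B0 sg1 t1 Dr DB; have t1' : `|t| <= 1 by rewrite ler_norml.
apply: (@chart_mesh R D _ _ _ (2 * B / r)) => //.
- by rewrite divr_ge0 ?mulr_ge0 // ltW.
- move=> s z s4 z1; apply: Dr => i.
  have z_le : `|z| <= 1 by rewrite ler_norml; lra.
  have v1 : `|sg * (r / 2) * z| <= r / 2.
    by rewrite normrM normrM sg1 mul1r gtr0_norm; nra.
  have [->|->] := ord2_cases i i12.
    by rewrite frame_coord1 // addrC addKr; lra.
  have v2 : `|sg * (r / 2) * t * z| <= r / 2.
    rewrite mulrAC normrM; have := normr_ge0 (sg * (r / 2) * z); nra.
  by rewrite frame_coord2 //; move: v2; rewrite !ler_norml; nra.
- move=> s z s4 /DB/(_ i1); rewrite frame_coord1 // addrC addKr.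
  rewrite normrM normrM sg1 mul1r gtr0_norm; last by lra.
  move=> zB; apply: le_trans (ler_norm _) _.
  by rewrite ler_pdivlMr //; lra.
Qed.

(* The slopes [-1 + m st] are dense enough for one of the half-strips to
   contain the point; the condition [`|u2| <= `|u1|] selects the axis. *)
Lemma frames_cover (R : realType) (B r u1 u2 : R) (N : nat)
    (st := r / (8 * B)) :
  0 < r -> 0 < B -> `|u1| <= B -> `|u2| <= `|u1| -> 2 / st < N%:R ->
  exists (sg : bool) (m : nat) s z, [/\ (m < N)%N /\ -1 <= -1 + m%:R * st <= 1,
    -1 <= s <= 1, 0 <= z, u1 = (-1) ^+ sg * (r / 2) * z &
    u2 = r / 8 * s + (-1) ^+ sg * (r / 2) * (-1 + m%:R * st) * z].
Proof.
move=> r0 B0 u1B u21 N_gt.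
have st0 : 0 < st by rewrite divr_gt0 ?mulr_gt0.
(* If [u1 = 0] then [u2 = 0] as well, and the quotient defaults to 0. *)
pose tau := u2 / u1.
have tauE : u2 = tau * u1.
  have [u10|u10] := eqVneq u1 0; last by rewrite /tau divfK.
  by move: u21; rewrite u10 normr0 normr_le0 mulr0 => /eqP.
have tau1 : `|tau| <= 1.
  have [u10|u10] := eqVneq u1 0; first by rewrite /tau u10 invr0 mulr0 normr0.
  by rewrite /tau normrM normfV ler_pdivrMr ?mul1r // normr_gt0.
rewrite ler_norml in tau1.
pose m := Num.truncn ((tau + 1) / st).
have q0 : 0 <= (tau + 1) / st by rewrite divr_ge0 ?(ltW st0) //; lra.
have /andP[m1 m2] := truncn_itv q0.
rewrite -/m ler_pdivlMr // in m1; rewrite -/m ltr_pdivrMr // -natr1 in m2.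
have mst : 0 <= m%:R * st by rewrite mulr_ge0 // ltW.
pose t := -1 + m%:R * st.
exists (u1 < 0), m, ((u2 - t * u1) / (r / 8)), (`|u1| / (r / 2)).
have u1E : u1 = (-1) ^+ (u1 < 0)%R * (r / 2) * (`|u1| / (r / 2)).
  have -> : (-1) ^+ (u1 < 0)%R * (r / 2) * (`|u1| / (r / 2)) =
      (-1) ^+ (u1 < 0)%R * `|u1| by field; rewrite gt_eqF.
  exact: numEsign.
split.
- split; last by lra.
  rewrite -(ltr_nat R); apply: le_lt_trans N_gt.
  by rewrite ler_pdivlMr //; lra.
- rewrite -ler_norml normrM normfV [X in _ / X]gtr0_norm ?divr_gt0 //.
  rewrite ler_pdivrMr ?divr_gt0 // mul1r tauE -mulrBl normrM.
  (* The slope error is at most [st] and the distance at most [B]; [st] is chosen so that [st * B]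
     is the half-width [r / 8] of the strip. *)
  apply: (@le_trans _ _ (st * B)).
    by rewrite ler_pM // ler_norml /t; lra.
  by rewrite /st le_eqVlt; apply/orP; left; apply/eqP; field; rewrite gt_eqF.
- by rewrite divr_ge0 // divr_ge0 // ltW.
- exact: u1E.
- have -> : (-1) ^+ (u1 < 0)%R * (r / 2) * (-1 + m%:R * st) * (`|u1| / (r / 2)) =
      t * u1 by rewrite [X in _ = t * X]u1E /t; ring.
  by field; rewrite gt_eqF.
Qed.

(** Charts are indexed by an axis, a side and a slope from a finite grid. A point is assigned to the
    axis along which it is farthest from the interior point [o]. *)
Lemma convex_half_mesh (R : realType) (D : set 'rV[R]_2) :
  convex_set D -> compact D -> interior D !=set0 -> half_mesh D D.
Proof.
move=> Dc cD; case=> o /nbhs_ballP[r0 /= r00 Dball].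
pose r := r0 / 2; have r_gt0 : 0 < r by rewrite divr_gt0.
have Dr (x : 'rV[R]_2) : (forall i, `|x ord0 i - o ord0 i| <= r) -> D x.
  move=> H; apply: Dball; split=> // i j; rewrite (ord1 i) /ball /= distrC.
  by apply: le_lt_trans (H j) _; rewrite /r; lra.
have [B B0 DB] : exists2 B : R, 0 < B & forall x, D x -> forall i, `|x ord0 i - o ord0 i| <= B.
  have [M [Mreal MP]] := compact_bounded cD.
  have coord (x : 'rV[R]_2) i : `|x ord0 i| <= `|x|.
    rewrite [leRHS]/Num.norm /= mx_normrE; apply/bigmax_geP; right => /=.
    by exists (ord0, i).
  exists (`|M| + 1 + `|o|); first by have := normr_ge0 M; have := normr_ge0 o; lra.
  move=> x Dx i; apply: le_trans (ler_normB _ _) _; apply: lerD => //.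
  apply: le_trans (coord x i) _; apply: MP => //.
  by have := ler_norm M; lra.
pose st := r / (8 * B).
pose N := (Num.truncn (2 / st)).+1.
have N_gt : 2 / st < N%:R by exact: truncnS_gt.
pose idx := [seq (x, m) | x <- [seq (i, sg) | i <- enum 'I_2, sg <- [:: true; false]],
  m <- [seq m <- iota 0 N | -1 <= -1 + m%:R * st <= 1]].
pose A (x : ('I_2 * bool) * nat) := [set y | D y /\ exists s z, [/\ -1 <= s <= 1, 0 <= z &
  y = chart o (frame_e (r / 8) (rev_ord x.1.1))
     (frame_v (r / 2) (-1 + x.2%:R * st) ((-1) ^+ x.1.2) x.1.1 (rev_ord x.1.1)) s z]].
have revN (i : 'I_2) : i != rev_ord i.
  by rewrite -(inj_eq val_inj) /=; have := ltn_ord i; lia.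
apply: (@half_mesh_subset _ _ _ [set x | exists2 i, i \in idx & A i x]); last first.
  apply: half_mesh_bigcup => -[[i sg] m] /allpairsP[[[j sg'] m'] [_ + E]].
  rewrite mem_filter => /andP[m1 _]; move: E m1 => [-> -> ->] m1.
  apply: (frame_half_mesh Dc cD (revN j) r_gt0 (ltW B0) _ m1 Dr DB).
  by rewrite normrX normrN1 expr1n.
move=> x Dx; pose u i := x ord0 i - o ord0 i.
have [i iP] : exists i, `|u (rev_ord i)| <= `|u i|.
  have [H|/ltW H] := leP `|u (rev_ord ord0)| `|u ord0|; first by exists ord0.
  by exists (rev_ord ord0); rewrite rev_ordK.
have [sg [m [s [z [[mN m1] s1 z0 u1 u2]]]]] :=
  frames_cover r_gt0 B0 (DB x Dx i) iP N_gt.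
exists ((i, sg), m).
  apply/allpairsP; exists ((i, sg), m); split=> //.
    by apply: allpairs_f; rewrite ?mem_enum // !inE; case: (sg).
  by rewrite mem_filter m1 mem_iota.
split=> //; exists s, z; split=> //; apply/rowP => k.
have [->|->] := ord2_cases k (revN i).
  by rewrite frame_coord1 // -/st -u1 /u addrC subrK.
by rewrite frame_coord2 // -addrA -/st -u2 /u addrC subrK.
Qed.

Theorem mainTheorem3 (R : realType) (D : set 'rV[R]_2)
    (D_convex : convex_set D) (D_compact : compact D)
    (D_interior : interior D !=set0) :
  exists mu nu : R, [/\ 0 < mu, 0 < nu &
    exists Y : nat -> {fset 'rV[R]_2}, forall n : nat, (1 <= n)%N ->
      [/\ [set` Y n] `<=` D,
          (#|` Y n|)%:R <= mu * n%:R ^+ 2 &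
          forall p : mpoly.mpoly 2 R, Pi2 n p ->
            max_abs D p <= nu * max_abs [set` Y n] p]].
Proof.
have [C C0 CP] := convex_half_mesh D_convex D_compact D_interior.
have D0 : D !=set0.
  by have [x /interior_subset Dx] := D_interior; exists x.
(* The factor 2 comes from absorbing [M / 2] in [M <= M / 2 + |p y|], where [M] is the maximum on
   [D]; adding 1 to [C] makes it positive. *)
exists (C + 1), 2; split=> //; first by rewrite ltr_wpDl.
have YP n : exists Y : {fset 'rV[R]_2}, (1 <= n)%N ->
    [/\ [set` Y] `<=` D, (#|` Y|)%:R <= (C + 1) * n%:R ^+ 2 &
       forall p : mpoly.mpoly 2 R, Pi2 n p ->
         max_abs D p <= 2 * max_abs [set` Y] p].
  have [n0|n0] := leqP 1 n; last by exists fset0.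
  have [s [ss sD H]] := CP n n0.
  exists [fset x in s]%fset => _; split.
  - by move=> x /=; rewrite inE; exact: sD.
  - rewrite card_fseq; apply: (@le_trans _ _ (size s)%:R).
      by rewrite ler_nat size_undup.
    by apply: le_trans ss _; rewrite ler_wpM2r ?sqr_ge0 //; lra.
  move=> p pn; have [[c Dc cE] pM] := max_absP p D0 D_compact.
  have [y ys] := H p _ pn pM c Dc.
  have Yy : [set` [fset x in s]%fset] y by rewrite /= inE.
  have [_ /(_ y Yy) py] := max_absP p (ex_intro _ y Yy) (finite_compact (finite_fset _)).
  have := ler_normD (peval p c - peval p y) (peval p y); rewrite subrK -cE.
  by lra.
by have [Y YP'] := choice YP; exists Y.
Qed.
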